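(* Let $\alpha\in(0,1)$, $T<\infty$, and let $X_1,X_2,\ldots$ be such that $(X_n)_{n\le T}$ are drawn from a distribution $P_0$ with parameter $\theta_0$, while $(X_n)_{n>T}$ are drawn from a product distribution $P_1$ with parameter $\theta_1\neq\theta_0$ and are independent of the pre-change observations. Apply the repeated-FCS-Detector with level-$(1-\alpha)$ confidence sequences whose diameters admit the deterministic envelope $w(n,P,\alpha)$ (with $\lim_{n\to\infty}w(n,P,\alpha)=0$ for all $P\in\mathcal{P}$ and $\alpha\in(0,1]$), and let $\tau$ be its stopping time. Let $\mathcal{E}=\{\theta_0\in\bigcap_{n=1}^T C^{(1)}_n\}$, an event of probability at least $1-\alpha$. (1) Non-partitioned problem: if $T$ is large enough that $w(T,P_0,\alpha)<d(\theta_0,\theta_1)$, then $$\mathbb{E}_T[(\tau-T)^+\mid\mathcal{E}]\le\frac{3}{1-\alpha}\,u(\theta_0,\theta_1,T),$$ where $$u(\theta_0,\theta_1,T)=\min\{n\ge1:\ w(T,P_0,\alpha)+w(n,P_1,\alpha)<d(\theta_0,\theta_1)\}.$$ (2) Partitioned problem, with known $\Theta_0$ ($\theta_0\in\Theta_0$, $\theta_1\notin\Theta_0$): for all values of $T<\infty$, $$\mathbb{E}_T[(\tau-T)^+]\le\frac{3}{1-\alpha}\,u(\Theta_0,\theta_1),\qquad u(\Theta_0,\theta_1)=\min\Big\{n\ge1:\ w(n,P_1,\alpha)<\inf_{\theta'\in\Theta_0}d(\theta',\theta_1)\Big\}.$$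
   Context: Setting. $\mathcal{X}$ is a general observation space, $\mathcal{P}$ is a class of probability distributions on $\mathcal{X}^\infty$, and $\theta:\mathcal{P}\to\Theta$ is a functional with values in a parameter space $\Theta$ equipped with a metric $d$. The observations $(X_n)_{n\le T}$ come from $P_0\in\mathcal{P}$ with $\theta(P_0)=\theta_0$ and $(X_n)_{n>T}$ from $P_1\in\mathcal{P}$ with $\theta(P_1)=\theta_1$; $T$ is the changepoint, and $\mathbb{P}_T,\mathbb{E}_T$ denote probability and expectation when the changepoint is $T$. Write $x^+=\max(x,0)$. Non-partitioned problem: nothing is known about $\theta_0,\theta_1$. Partitioned problem: a set $\Theta_0\subset\Theta$ is known, with $\theta_0\in\Theta_0$ and $\theta_1\notin\Theta_0$. Confidence sequence (CS). Given observations drawn from a distribution $P$, a level-$(1-\alpha)$ CS for $\theta(P)$ is a sequence of sets $C_n\subset\Theta$ such that $C_n$ is measurable with respect to the first $n$ observations and $\mathbb{P}(\forall n\in\mathbb{N}:\theta(P)\in C_n)\ge1-\alpha$. Width assumption. The diameter of the CS after $n$ observations from $P$ has a deterministic bound: almost surely $\sup_{\theta',\theta''\in C_n}d(\theta',\theta'')\le w(n,P,\alpha)$, with $\lim_{n\to\infty}w(n,P,\alpha)=0$ for all $P\in\mathcal{P}$, $\alpha\in(0,1]$. repeated-FCS-Detector. For every $m\ge1$ a level-$(1-\alpha)$ CS $C^{(m)}=(C^{(m)}_n)_{n\ge m}$ is started at time $m$, where $C^{(m)}_n$ is formed from $X_m,\ldots,X_n$ only (so it is based on $n-m+1$ observations).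 Concretely, the CS and width properties are used as follows: $\mathbb{P}_T(\theta_0\in\bigcap_{n=1}^T C^{(1)}_n)\ge1-\alpha$ and the diameter of $C^{(1)}_n$ is a.s. at most $w(n,P_0,\alpha)$ for $n\le T$; and for every $m>T$, $\mathbb{P}_T(\forall n\ge m:\theta_1\in C^{(m)}_n)\ge1-\alpha$ and the diameter of $C^{(m)}_n$ is a.s. at most $w(n-m+1,P_1,\alpha)$ for $n\ge m$. Set $C^{(0)}_n=\Theta$ for all $n$ (non-partitioned) or $C^{(0)}_n=\Theta_0$ for all $n$ (partitioned). The CSs are taken nested without loss of generality ($C^{(m)}_n\subset C^{(m)}_{n'}$ for $m\le n'<n$), and $$\tau=\inf\Big\{n\ge1:\ \bigcap_{m=0}^n C^{(m)}_n=\emptyset\Big\};$$ if they are not nested, the criterion is $\bigcap_{m=0}^n\bigcap_{i=m}^n C^{(m)}_i=\emptyset$. Conventions: $\inf\emptyset=\min\emptyset=\infty$. *)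

(* Defs.v *)
From HB Require Import structures.
From mathcomp Require Import all_boot all_order all_algebra.
From mathcomp Require Import all_classical all_reals all_analysis.
Set Implicit Arguments.
Unset Strict Implicit.
Unset Printing Implicit Defensive.
Import Order.TTheory GRing.Theory Num.Theory.
Import numFieldNormedType.Exports.
Local Open Scope classical_set_scope.
Local Open Scope ring_scope.
Local Open Scope ereal_scope.

(* The events {Y i \in B}, i in I and B measurable. *)
Definition obs_events (S : Type) d (X : measurableType d) (Y : nat -> S -> X)
    (I : set nat) : set (set S) :=
  \bigcup_(i in I) preimage_set_system setT (Y i) measurable.

(* sigma(Y i, i in I) *)
Definition obs_sigma (S : Type) d (X : measurableType d) (Y : nat -> S -> X)
    (I : set nat) : set (set S) :=
  <<s obs_events Y I >>.

Definition seq_coord (X : Type) (k : nat) (x : nat -> X) : X := x k.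

(* X^oo with its product sigma-algebra; coordinates are numbered from 0, so a
   sequence of observations X_1, X_2, ... is the point (fun k => X_(1 + k)). *)
Definition seq_space d (X : measurableType d) :=
  g_sigma_algebraType (obs_events (@seq_coord X) setT).

Definition obs_from (Om X : Type) (Y : nat -> Om -> X) (m : nat)
    (om : Om) : nat -> X :=
  fun k => Y (m + k)%N om.

(* Independent, not necessarily identically distributed, coordinates. *)
Definition product_distribution d (X : measurableType d) (R : realType)
    (P : probability (seq_space X) R) : Prop :=
  forall (n : nat) (B : nat -> set X), (forall i, measurable (B i)) ->
    P [set x | forall i, (i < n)%N -> B i (x i)] =
    \prod_(i < n) P (@seq_coord X i @^-1` B i).

Definition indep_events dO (Om : measurableType dO) (R : realType)
    (Pr : probability Om R) (F G : set (set Om)) : Prop :=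
  forall A B, F A -> G B -> Pr (A `&` B) = Pr A * Pr B.

(* The observation at time n >= 1 is Y n; Y 0 plays no role.  Under Pr the
   changepoint is T: (Y n)_(1 <= n <= T) has the law of the first T coordinates
   under P0, and the sequence Y_(T+1), Y_(T+2), ... has law P1 and is
   independent of the pre-change observations. *)
Definition change_model dO (Om : measurableType dO) (R : realType)
    (Pr : probability Om R) d (X : measurableType d) (Y : nat -> Om -> X)
    (T : nat) (P0 P1 : probability (seq_space X) R) : Prop :=
  [/\ forall n, measurable_fun setT (Y n),
      forall A : set (seq_space X), obs_sigma (@seq_coord X) `I_T A ->
        Pr (obs_from Y 1 @^-1` A) = P0 A,
      forall A : set (seq_space X), measurable A ->
        Pr (obs_from Y T.+1 @^-1` A) = P1 A &
      indep_events Pr (obs_sigma Y [set n | (1 <= n <= T)%N])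
                      (obs_sigma Y [set n | (T < n)%N])].

Definition diam (R : realType) (Th : metricType R) (A : set Th) : \bar R :=
  ereal_sup [set (mdist p.1 p.2)%:E | p in A `*` A].

Definition dist_to (R : realType) (Th : metricType R) (A : set Th) (t : Th) :
    \bar R :=
  ereal_inf [set (mdist s t)%:E | s in A].

(* min {n >= 1 : Q n}, equal to +oo when there is no such n. *)
Definition first_time (R : realType) (Q : nat -> Prop) : \bar R :=
  ereal_inf [set n%:R%:E | n in [set n | (1 <= n)%N /\ Q n]].

(* C m n is C^(m)_n, meaningful for 1 <= m <= n; C^(0)_n is the constant C0. *)
Definition with_C0 (Om Th : Type) (C0 : set Th)
    (C : nat -> nat -> Om -> set Th) (m n : nat) (om : Om) : set Th :=
  if m is 0%N then C0 else C m n om.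

(* Stopping time of the repeated-FCS-Detector, by the criterion that does not
   presuppose nested confidence sequences; see repeated_FCS_nested. *)
Definition repeated_FCS (R : realType) (Om Th : Type) (C0 : set Th)
    (C : nat -> nat -> Om -> set Th) (om : Om) : \bar R :=
  first_time R (fun n =>
    \bigcap_(m in [set m | (m <= n)%N])
      \bigcap_(i in [set i | (m <= i <= n)%N]) with_C0 C0 C m i om = set0).

Lemma repeated_FCS_nested (R : realType) (Om Th : Type) (C0 : set Th)
    (C : nat -> nat -> Om -> set Th) (om : Om) :
  (forall m n n', (1 <= m <= n')%N -> (n' < n)%N ->
     C m n om `<=` C m n' om) ->
  repeated_FCS R C0 C om =
  first_time R (fun n =>
    \bigcap_(m in [set m | (m <= n)%N]) with_C0 C0 C m n om = set0).
Proof.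
move=> nest; congr (first_time R _); apply/funext => n; congr (_ = set0).
apply: eq_bigcapr => m /= mn; apply/seteqP; split => t.
  by move=> /(_ n); apply; rewrite /= mn leqnn.
case: m mn => [|m] mn Ct i; first by [].
move=> /= /andP[mi]; rewrite leq_eqVlt => /predU1P[->//|ltin].
by apply: (nest m.+1 n i) => //; rewrite mi.
Qed.

(* (tau - T)^+ *)
Definition delay (R : realType) (Om : Type) (T : nat) (tau : Om -> \bar R)
    (om : Om) : \bar R :=
  maxe (tau om - T%:R%:E) 0.

(* E[f | A] for an event A of positive probability *)
Definition cond_expectation dO (Om : measurableType dO) (R : realType)
    (Pr : probability Om R) (A : set Om) (f : Om -> \bar R) : \bar R :=
  (\int[Pr]_(om in A) f om) / Pr A.

(* Main.v *)
Require Import Defs.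
From HB Require Import structures.
From mathcomp Require Import all_boot all_order all_algebra.
From mathcomp Require Import all_classical all_reals all_analysis.
From mathcomp Require Import measurable_realfun.
From mathcomp Require Import zify.
Import Order.TTheory GRing.Theory Num.Theory.
Import numFieldNormedType.Exports.
Local Open Scope classical_set_scope.
Local Open Scope ring_scope.
Local Open Scope ereal_scope.

(** Let u be one of the sample sizes over which the minimum defining the
    bound is taken, and cut the time after the changepoint into consecutive
    blocks of length u. The confidence sequence started at the beginning of
    block k has almost surely, at the end of that block, diameter at most
    w(u, P1, alpha). If it also contains theta_1 (call this a success of
    the block), then by the triangle inequality it is disjoint from
    C^(1)_T, in the non-partitioned problem on the event that C^(1)_T
    contains theta_0, or from Theta_0, in the partitioned problem. The
    detector therefore stops no later than the end of the first successful
    block.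

    A block fails with probability at most alpha. Whether it fails depends
    only on its own observations. Failures of different blocks are
    therefore independent of each other, P1 being a product distribution,
    and of the pre-change event E, by the independence assumed across the
    changepoint (lemmas [post_change_blocks_indep] and
    [failures_given_pre]): the first j blocks all fail, on E, with
    probability at most alpha^j Pr(E). The delay is almost surely at most u
    times the number of j such that the first j blocks all fail, and the
    geometric series gives an expected delay of at most u / (1 - alpha)
    times Pr(E) (lemma [integral_delay_le]). This is already below the
    claimed bound, whose factor 3 is slack.

    The stopping time need not be measurable, because emptiness of an
    intersection is an uncountable condition on the parameter. The integral
    of a nonnegative function is the supremum of the integrals of the
    simple functions below it, so it remains monotone, and only the upper
    bound for the delay has to be measurable (lemma
    [lower_integral_ae_le]). *)

(** * Monotonicity of the integral without measurability *)

Section lower_integral.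
Import HBNNSimple.

(** Simple functions below [f] are almost everywhere below [g], and their
    integrals can be compared with that of [g] since both are measurable; the
    supremum over them is the integral of [f], which may be nonmeasurable. *)
Lemma lower_integral_ae_le {d} {S : measurableType d} {R : realType}
    (mu : {measure set S -> \bar R}) (D : set S) (f g : S -> \bar R) :
  measurable D -> measurable_fun D g ->
  (forall x, D x -> 0 <= f x) -> (forall x, D x -> 0 <= g x) ->
  {ae mu, forall x, D x -> f x <= g x} ->
  \int[mu]_(x in D) f x <= \int[mu]_(x in D) g x.
Proof.
move=> mD mg f0 g0 fg; rewrite (integral_mkcond D f) (integral_mkcond D g).
rewrite ge0_integralTE; last exact: erestrict_ge0.
apply: ge_ereal_sup => _ [/= h hf <-]; rewrite -integralT_nnsfun.
apply: ae_ge0_le_integral => //.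
- by move=> x _; rewrite lee_fin.
- exact/measurable_EFinP.
- by move=> x _; exact: erestrict_ge0.
- exact/(measurable_restrictT _ _).1.
apply: filterS fg => x fgx _; apply: le_trans (hf x) _.
by rewrite !patchE; case: ifPn => // /set_mem /fgx.
Qed.

End lower_integral.

(** * Independence of generated sigma-algebras *)

Lemma indep_eventsC {dO} {Om : measurableType dO} {R : realType}
    (Pr : probability Om R) (F G : set (set Om)) :
  indep_events Pr F G -> indep_events Pr G F.
Proof. by move=> FG A B GA FB; rewrite setIC FG// muleC. Qed.

(** For a fixed [B] in [G], the events independent of [B] form a Dynkin system;
    it contains the pi-system [F], hence the sigma-algebra that [F] generates. *)
Lemma indep_g_sigma_algebral {dO} {Om : measurableType dO} {R : realType}
    (Pr : probability Om R) (F G : set (set Om)) :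
  setI_closed F -> F `<=` measurable -> G `<=` measurable ->
  indep_events Pr F G -> indep_events Pr <<s F >> G.
Proof.
move=> FI mF mG FG A B sA GB; have mB := mG _ GB.
pose H := [set A | measurable A /\ Pr (A `&` B) = Pr A * Pr B].
have sFH : <<s F >> `<=` H; last by case: (sFH A sA).
rewrite -setI_closed_g_dynkin_g_sigma_algebra//; apply: smallest_sub; last first.
  by move=> D FD; split; [exact: mF|exact: FG].
split.
- by split=> //; rewrite setTI probability_setT mul1e.
- move=> D [mD DB]; split; first exact: measurableC.
  rewrite setIC -setDE measureD//; last by rewrite ltey_eq fin_num_measure.
  rewrite [X in _ - X](_ : _ = Pr D * Pr B); last by rewrite setIC; exact: DB.
  by rewrite probability_setC// muleBl ?mul1e// ?fin_num_measure.
- move=> D tD HD; have mD n : measurable (D n) by case: (HD n).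
  split; first exact: bigcup_measurable.
  rewrite setI_bigcupl !measure_bigcup//; last 2 first.
  + by move=> i _; exact: measurableI.
  + exact: trivIset_setIr.
  rewrite muleC -(fineK (fin_num_measure Pr B mB)) -nneseriesZl//.
  apply: eq_eseriesr => i _; rewrite fineK ?fin_num_measure// muleC.
  by case: (HD i).
Qed.

Lemma indep_g_sigma_algebra {dO} {Om : measurableType dO} {R : realType}
    (Pr : probability Om R) (F G : set (set Om)) :
  setI_closed F -> setI_closed G -> F `<=` measurable -> G `<=` measurable ->
  indep_events Pr F G -> indep_events Pr <<s F >> <<s G >>.
Proof.
move=> FI GI mF mG FG.
have sFG : indep_events Pr <<s F >> G by exact: indep_g_sigma_algebral.
apply/indep_eventsC/indep_g_sigma_algebral => //; last exact: indep_eventsC.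
by apply: smallest_sub => //; exact: sigma_algebra_measurable.
Qed.

(** * Independence of post-change blocks *)

(** Unlike [obs_events], this generating family is closed under intersection,
    as the pi-lambda argument requires. *)
Definition cylinders {S d} {X : measurableType d} (Y : nat -> S -> X)
    (I : set nat) : set (set S) :=
  [set A | exists2 B : nat -> set X, (forall i, measurable (B i)) &
     A = \bigcap_(i in I) Y i @^-1` B i].

Lemma setI_closed_cylinders {S d} {X : measurableType d} (Y : nat -> S -> X)
    (I : set nat) : setI_closed (cylinders Y I).
Proof.
move=> _ _ [B mB ->] [B' mB' ->]; exists (fun i => B i `&` B' i).
  by move=> i; exact: measurableI.
by rewrite -bigcapI.
Qed.

Lemma obs_sigma_sub_cylinders {S d} {X : measurableType d} (Y : nat -> S -> X)
    (I : set nat) : obs_sigma Y I `<=` <<s cylinders Y I >>.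
Proof.
apply: smallest_sub; first exact: smallest_sigma_algebra.
move=> _ [i Ii [B mB <-]]; apply: sub_sigma_algebra.
exists (fun j => if j == i then B else setT); first by move=> j; case: ifP.
rewrite setTI; apply/seteqP; split=> [om /= YB j _ | om /= /(_ i Ii)].
  by rewrite /preimage /=; case: eqP => [->|].
by rewrite /= eqxx.
Qed.

Lemma cylinders_measurable {dO} {Om : measurableType dO} {d}
    {X : measurableType d} (Y : nat -> Om -> X) (I : set nat) :
  (forall n, measurable_fun setT (Y n)) -> cylinders Y I `<=` measurable.
Proof.
move=> mY _ [B mB ->]; apply: bigcap_measurableType => i _.
by rewrite -[_ @^-1` _]setTI; exact: mY.
Qed.

Lemma obs_sigma_measurable {dO} {Om : measurableType dO} {d}
    {X : measurableType d} (Y : nat -> Om -> X) (I : set nat) :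
  (forall n, measurable_fun setT (Y n)) -> obs_sigma Y I `<=` measurable.
Proof.
move=> mY A /obs_sigma_sub_cylinders; move: A; apply: smallest_sub.
  exact: sigma_algebra_measurable.
exact: cylinders_measurable.
Qed.

Lemma obs_sigma_subset {S d} {X : measurableType d} (Y : nat -> S -> X)
    (I J : set nat) : I `<=` J -> obs_sigma Y I `<=` obs_sigma Y J.
Proof.
move=> IJ; apply: smallest_sub; first exact: smallest_sigma_algebra.
by move=> A [i /IJ Ji YA]; apply: sub_sigma_algebra; exists i.
Qed.

Section change_model.
Context {R : realType} {dX : measure_display} {X : measurableType dX}
  {dO : measure_display} {Om : measurableType dO}.
Variables (Pr : probability Om R) (Y : nat -> Om -> X) (T : nat).
Variables P0 P1 : probability (seq_space X) R.
Hypothesis P1_prod : product_distribution P1.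
Hypothesis Y_model : change_model Pr Y T P0 P1.

(** The product structure of [P1], transported to the sample space: coordinate
    number [k] of the post-change sequence is the observation at time
    [T.+1 + k]. *)
Lemma post_change_cylinder (b : nat) (B : nat -> set X) :
  (T <= b)%N -> (forall i, measurable (B i)) ->
  Pr (\bigcap_(i in [set i | (T < i <= b)%N]) Y i @^-1` B i) =
  \prod_(T.+1 <= i < b.+1) Pr (Y i @^-1` B i).
Proof.
move=> Tb mB; case: Y_model => _ _ law _.
pose n := (b - T)%N.
have mcoord i (D : set X) : measurable D ->
    measurable (@seq_coord X i @^-1` D : set (seq_space X)).
  by move=> mD; apply: sub_sigma_algebra; exists i => //; exists D; rewrite ?setTI.
transitivity (P1 [set x | forall i, (i < n)%N -> B (T.+1 + i)%N (x i)]).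
  rewrite -law; last first.
    have -> : [set x : seq_space X | forall i, (i < n)%N -> B (T.+1 + i)%N (x i)]
        = \bigcap_(i in `I_n) (@seq_coord X i @^-1` B (T.+1 + i)%N) by [].
    by apply: bigcap_measurableType => i _; exact: mcoord.
  congr (Pr _); apply/seteqP; split=> om /= YB i.
    by move=> ni; apply: YB => /=; rewrite /n in ni; lia.
  move=> /= Tib; have := YB (i - T.+1)%N; rewrite /obs_from /preimage /=.
  by rewrite subnKC; [apply; rewrite /n; lia|lia].
rewrite [LHS](P1_prod n (fun i => B (T.+1 + i)%N))//.
rewrite -[X in index_iota X _]add0n big_addn subSS big_mkord; apply: eq_bigr => i _.
rewrite -law; last exact: mcoord.
by rewrite [in RHS](addnC i).
Qed.

(** By the pi-lambda theorem it is enough to treat two cylinders.  Each of them,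
    and their intersection, is a cylinder over the times in (T, b], and the
    product over these times splits at [a]. *)
Lemma post_change_blocks_indep (a b : nat) : (T <= a <= b)%N ->
  indep_events Pr (obs_sigma Y [set i | (T < i <= a)%N])
                  (obs_sigma Y [set i | (a < i <= b)%N]).
Proof.
move=> /andP[Ta ab] A A' /obs_sigma_sub_cylinders sA.
move=> /obs_sigma_sub_cylinders; move: A A' sA.
have mY : forall n, measurable_fun setT (Y n) by case: Y_model.
apply: indep_g_sigma_algebra; try exact: setI_closed_cylinders.
- exact: cylinders_measurable.
- exact: cylinders_measurable.
move=> _ _ [B mB ->] [B' mB' ->].
(* [glue D] prescribes [D] up to time [a] and [B'] afterwards: [glue B] is the
   intersection, and [glue setT] is the second cylinder over the longer range. *)
pose glue (D : nat -> set X) i := if (i <= a)%N then D i else B' i.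
have mglue D : (forall i, measurable (D i)) -> forall i, measurable (glue D i).
  by move=> mD i; rewrite /glue; case: ifP.
have -> : \bigcap_(i in [set i | (a < i <= b)%N]) Y i @^-1` B' i =
    \bigcap_(i in [set i | (T < i <= b)%N]) Y i @^-1` glue (fun=> setT) i.
  apply/seteqP; split=> om /= YB i /= iab; have := YB i; rewrite /glue /=.
    by rewrite /preimage /=; case: (leqP i a) => // ai; apply; lia.
  by rewrite /preimage /=; case: (leqP i a) => ia; [lia|apply; lia].
rewrite (_ : _ `&` _ =
    \bigcap_(i in [set i | (T < i <= b)%N]) Y i @^-1` glue B i); last first.
  apply/seteqP; split=> om /=.
    move=> [YB YB'] i /= iTb; have := YB i; have := YB' i.
    by rewrite /glue /preimage /=; case: (leqP i a) => ia;
      [move=> _|move=> + _]; apply; lia.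
  move=> YB; split=> i /= iab; have := YB i; rewrite /glue /preimage /=.
    by case: (leqP i a) => ia; [apply; lia|lia].
  by case: (leqP i a) => // ia; apply.
rewrite !post_change_cylinder//; [|lia|exact: mglue|lia|exact: mglue].
have TSa : (T.+1 <= a.+1)%N by []. have aSb : (a.+1 <= b.+1)%N by [].
rewrite (big_cat_nat TSa aSb)/= [in RHS](big_cat_nat TSa aSb)/=.
rewrite [X in _ = _ * (X * _)]big1_seq ?mul1e; last first.
  move=> i /andP[_]; rewrite mem_index_iota ltnS => /andP[_ ia].
  by rewrite /glue ia preimage_setT probability_setT.
congr (_ * _); apply: eq_big_nat => i /andP[Ti ia]; rewrite /glue.
  by rewrite -ltnS ia.
by rewrite leqNgt Ti.
Qed.

End change_model.

(** * Runs of failing blocks *)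

Section no_success.
Context {R : realType} {dX : measure_display} {X : measurableType dX}
  {dO : measure_display} {Om : measurableType dO}.
Variables (Pr : probability Om R) (Y : nat -> Om -> X) (T : nat).
Variables P0 P1 : probability (seq_space X) R.
Hypothesis P1_prod : product_distribution P1.
Hypothesis Y_model : change_model Pr Y T P0 P1.

(** The measurability and the bound are proved together because the induction
    step applies independence to the event that the first [j] blocks fail. *)
Lemma block_failures (u : nat) (B : nat -> set Om) (q : R) (j : nat) :
  (0 <= q)%R ->
  (forall k, obs_sigma Y [set i | (T + k * u < i <= T + k.+1 * u)%N] (B k)) ->
  (forall k, Pr (B k) <= q%:E) ->
  obs_sigma Y [set i | (T < i <= T + j * u)%N] (\bigcap_(k < j) B k) /\
  Pr (\bigcap_(k < j) B k) <= (q ^+ j)%:E.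
Proof.
move=> q0 sB PB; rewrite bigcap_mkord.
elim: j => [|j [sF PF]].
  rewrite big_ord0 probability_setT; split => //.
  exact: (@measurableT _ (g_sigma_algebraType (obs_events Y _))).
rewrite big_ord_recr/=; split.
  apply: (@measurableI _ (g_sigma_algebraType (obs_events Y _))).
    by apply: obs_sigma_subset sF => i /=; rewrite mulSn; lia.
  by apply: obs_sigma_subset (sB j) => i /=; rewrite mulSn; lia.
have indep : indep_events Pr (obs_sigma Y [set i | (T < i <= T + j * u)%N])
    (obs_sigma Y [set i | (T + j * u < i <= T + j.+1 * u)%N]).
  by apply: (post_change_blocks_indep _ _ _ _ _ P1_prod Y_model); rewrite mulSn; lia.
by rewrite indep// exprSr EFinM lee_pmul.
Qed.

Lemma failures_given_pre (E : set Om) (u : nat) (B : nat -> set Om) (q : R)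
    (j : nat) :
  (0 <= q)%R -> obs_sigma Y [set n | (1 <= n <= T)%N] E ->
  (forall k, obs_sigma Y [set i | (T + k * u < i <= T + k.+1 * u)%N] (B k)) ->
  (forall k, Pr (B k) <= q%:E) ->
  Pr (E `&` \bigcap_(k < j) B k) <= (q ^+ j)%:E * Pr E.
Proof.
move=> q0 sE sB PB; have [sF PF] := block_failures u B q j q0 sB PB.
case: Y_model => _ _ _ indep; rewrite indep//; last first.
  by apply: obs_sigma_subset sF => i /= /andP[].
by rewrite muleC lee_wpmul2r.
Qed.

End no_success.

(** The delay is bounded pointwise by [u] times the number of [j] such that the
    first [j] blocks fail: if block [k] is the first to succeed, this number is
    [k.+1], which counts [j = 0], and if no block succeeds it is infinite.
    Monotone convergence then integrates this bound term by term. *)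
Lemma integral_delay_le {R : realType} {dO} {Om : measurableType dO}
    (Pr : probability Om R) (E : set Om) (B : nat -> set Om) (tau : Om -> \bar R)
    (T u : nat) (q : R) :
  measurable E -> (forall k, measurable (B k)) -> (0 < u)%N -> (0 < q < 1)%R ->
  (forall j, Pr (E `&` \bigcap_(k < j) B k) <= (q ^+ j)%:E * Pr E) ->
  {ae Pr, forall om, E om ->
     forall k, ~ B k om -> tau om <= (T + k.+1 * u)%:R%:E} ->
  \int[Pr]_(om in E) delay T tau om <= (u%:R / (1 - q))%:E * Pr E.
Proof.
move=> mE mB u0 /andP[q0 q1] PB tauB.
have mF j : measurable (\bigcap_(k < j) B k) by exact: bigcap_measurableType.
pose N om := \sum_(j <oo) u%:R%:E * (\1_(\bigcap_(k < j) B k) om)%:E : \bar R.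
have term0 j om : 0 <= u%:R%:E * (\1_(\bigcap_(k < j) B k) om)%:E :> \bar R.
  by rewrite -EFinM lee_fin.
have mterm j D : measurable_fun D
    (fun om => u%:R%:E * (\1_(\bigcap_(k < j) B k) om)%:E : \bar R).
  by apply: measurable_funeM; exact/measurable_EFinP/measurable_indic.
have N_ge om j : (\bigcap_(k < j) B k) om -> (j.+1 * u)%:R%:E <= N om.
  move=> Bj; apply: le_trans (nneseries_lim_ge j.+1 _); last by [].
  rewrite (eq_big_nat _ _ (F2 := fun=> u%:R%:E)); last first.
    move=> i /andP[_ ij]; rewrite indicE mem_set ?mule1// => k /= ki; apply: Bj.
    exact: leq_trans ki ij.
  by rewrite sumEFin lee_fin big_const_nat subn0 iter_addr_0 mulnC natrM mulr_natr.
have delay_N : {ae Pr, forall om, E om -> delay T tau om <= N om}.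
  apply: filterS tauB => om H Eom; have {}H := H Eom.
  rewrite /delay ge_max; apply/andP; split; last exact: nneseries_ge0.
  have [[k nBk]|allB] := pselect (exists k, ~ B k om); last first.
    suff -> : N om = +oo by rewrite leey.
    apply: eq_infty => r; apply: le_trans (N_ge om (Num.truncn r) _); last first.
      by move=> k _; apply: contrapT => nB; apply: allB; exists k.
    rewrite lee_fin; apply: le_trans (ltW (truncnS_gt _)) _.
    by rewrite ler_nat leq_pmulr.
  have exB : exists k, `[< ~ B k om >] by exists k; exact/asboolP.
  case: (ex_minnP exB) => {nBk}k /asboolP nBk kmin.
  apply: le_trans (N_ge om k _); last first.
    move=> i /= ik; apply: contrapT => /asboolP /kmin; lia.
  rewrite leeBlDr// (le_trans (H k nBk))//.
  by rewrite -EFinD lee_fin -natrD ler_nat addnC.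
apply: (@le_trans _ _ (\int[Pr]_(om in E) N om)).
  apply: lower_integral_ae_le => //.
  - exact: ge0_emeasurable_sum.
  - by move=> om _; rewrite /delay le_max lexx orbT.
  - by move=> om _; exact: nneseries_ge0.
rewrite integral_nneseries//.
have PE : Pr E = (fine (Pr E))%:E by rewrite fineK ?fin_num_measure.
apply: lime_le; first by apply: is_cvg_nneseries => j _ _; exact: integral_ge0.
apply: nearW => n.
apply: (@le_trans _ _ (\sum_(0 <= j < n) (u%:R%:E * (q ^+ j)%:E * Pr E))).
  apply: lee_sum => j _; rewrite ge0_integralZl_EFin//; last first.
    exact/measurable_EFinP/measurable_indic.
  rewrite integral_indic// setIC -muleA; apply: lee_wpmul2l; last exact: PB.
  by rewrite lee_fin.
rewrite PE; under eq_bigr do rewrite -!EFinM.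
rewrite sumEFin -EFinM lee_fin -mulr_suml ler_wpM2r ?fine_ge0//.
rewrite -mulr_sumr ler_wpM2l//.
have := @geometric_le_lim R n 1 q ler01 q0; rewrite gtr0_norm// => /(_ q1).
by rewrite mul1r -exprn_geometric.
Qed.

(** * Delay of the detector *)

Lemma mdist_le_diam {R : realType} {Th : metricType R} (A : set Th) (s t : Th) :
  A s -> A t -> (mdist s t)%:E <= diam A.
Proof. by move=> As At; apply: ereal_sup_ubound; exists (s, t). Qed.

(** Comparing [L] with every admissible [n] handles at once the case where
    [first_time] is attained and the case where it is infinite. *)
Lemma le_mul_first_time {R : realType} (c : R) (L : \bar R) (Q : nat -> Prop) :
  (0 < c)%R ->
  (forall n, (1 <= n)%N -> Q n -> L <= c%:E * n%:R%:E) ->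
  L <= c%:E * first_time R Q.
Proof.
move=> c0 LQ; rewrite -lee_pdivrMl//; apply: le_ereal_inf_tmp.
by move=> _ [n [n1 Qn] <-]; rewrite lee_pdivrMl//; exact: LQ.
Qed.

(** Both problems at once: the last hypothesis says that, on [E], every set which
    contains [th1] and has diameter at most [W] is incompatible with what
    is available at the changepoint, be it [C0] or a confidence set from the
    pre-change data.  The width hypothesis gives such a set at the end of
    every block in which [th1] is covered. *)
Lemma integral_repeated_FCS_delay_le {R : realType} {dX} {X : measurableType dX}
    {Th : metricType R} (th1 : Th) (W : \bar R) (alpha : R)
    {dO} {Om : measurableType dO} (Pr : probability Om R)
    (Y : nat -> Om -> X) (T : nat) (P0 P1 : probability (seq_space X) R)
    (C0 : set Th) (C : nat -> nat -> Om -> set Th) (E : set Om) (u : nat) :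
  (0 < alpha < 1)%R -> product_distribution P1 -> change_model Pr Y T P0 P1 ->
  (forall m n t, (1 <= m <= n)%N ->
     obs_sigma Y [set i | (m <= i <= n)%N] [set om | C m n om t]) ->
  (forall m, (T < m)%N ->
     (1 - alpha)%:E <= Pr [set om | forall n, (m <= n)%N -> C m n om th1]) ->
  (forall m n, (T < m <= n)%N -> (n - m + 1)%N = u ->
     {ae Pr, forall om, diam (C m n om) <= W}) ->
  (0 < u)%N -> obs_sigma Y [set n | (1 <= n <= T)%N] E ->
  {ae Pr, forall om, E om -> forall A : set Th, A th1 -> diam A <= W ->
     forall t, A t ->
     exists m i, (m <= i <= T)%N /\ ~ with_C0 C0 C m i om t} ->
  \int[Pr]_(om in E) delay T (repeated_FCS R C0 C) om <=
  (u%:R / (1 - alpha))%:E * Pr E.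
Proof.
move=> alpha01 P1_prod Y_model C_adapted C_cover C_width u0 sE sep.
have mY : forall n, measurable_fun setT (Y n) by case: Y_model.
have /andP[alpha0 alpha1] := alpha01.
(* Block [k] is the time interval (a k, a (k + 1)], and [B k] its failure. *)
pose a k := (T + k * u)%N.
have aS k : a k.+1 = (a k + u)%N by rewrite /a mulSn; lia.
pose B k := [set om | ~ C (a k).+1 (a k.+1) om th1].
have mC m n : (1 <= m <= n)%N -> measurable [set om | C m n om th1].
  by move=> mn; apply: (obs_sigma_measurable _ _ mY); exact: C_adapted.
have sB k : obs_sigma Y [set i | (a k < i <= a k.+1)%N] (B k).
  have := @measurableC _ (g_sigma_algebraType
    (obs_events Y [set i | (a k < i <= a k.+1)%N])) _
    (C_adapted (a k).+1 (a k.+1) th1 _).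
  by apply; rewrite aS; lia.
have mB k : measurable (B k) by exact: obs_sigma_measurable (sB k).
apply: (integral_delay_le _ _ B) => //.
- exact: obs_sigma_measurable sE.
- move=> j; apply: (failures_given_pre _ _ _ _ _ P1_prod Y_model _ u) => //.
    exact: ltW.
  move=> k; rewrite [B k](_ : _ = ~` [set om | C (a k).+1 (a k.+1) om th1])//.
  rewrite probability_setC; last by apply: mC; rewrite aS; lia.
  rewrite leeBlDr ?fin_num_measure//; last by apply: mC; rewrite aS; lia.
  rewrite -leeBlDl// -EFinB; apply: le_trans (C_cover (a k).+1 _) _.
    by rewrite /a; lia.
  apply: le_measure; rewrite ?inE.
  + rewrite [X in measurable X](_ : _ = \bigcap_(n in [set n | (a k < n)%N])
        [set om | C (a k).+1 n om th1]); last by [].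
    by apply: bigcap_measurableType => n akn; apply: mC.
  + by apply: mC; rewrite aS; lia.
  + by move=> om; apply; rewrite aS; lia.
have width : {ae Pr, forall om, forall k,
    diam (C (a k).+1 (a k.+1) om) <= W}.
  apply: ae_foralln => k; apply: C_width; rewrite aS /a; lia.
apply: filterS2 sep width => om sepom widthom Eom k /contrapT Ck.
apply: ereal_inf_lbound; exists (a k.+1) => //; split; first by rewrite aS; lia.
apply/seteqP; split=> // t Ct.
have Ckt : C (a k).+1 (a k.+1) om t.
  by apply: (Ct (a k).+1 _ (a k.+1)) => /=; rewrite aS; lia.
have [m [i [miT]]] := sepom Eom _ Ck (widthom k) t Ckt.
by apply; apply: (Ct m _ i) => /=; rewrite /a; lia.
Qed.
Theorem theorem2p5
  (R : realType)
  (* observation space, parameter space, class of distributions, functional *)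
  (dX : measure_display) (X : measurableType dX)
  (Th : metricType R)
  (PP : set (probability (seq_space X) R))
  (theta : probability (seq_space X) R -> Th)
  (* width envelope w(n, P, alpha) *)
  (w : nat -> probability (seq_space X) R -> R -> \bar R)
  (w_lim : forall (P : probability (seq_space X) R) (a : R),
     PP P -> (0 < a <= 1)%R -> w n P a @[n --> \oo] --> 0)
  (alpha : R) (alpha01 : (0 < alpha < 1)%R)
  (* observations Y 1, Y 2, ... with changepoint T *)
  (dO : measure_display) (Om : measurableType dO) (Pr : probability Om R)
  (Y : nat -> Om -> X) (T : nat)
  (P0 P1 : probability (seq_space X) R)
  (PP0 : PP P0) (PP1 : PP P1)
  (P1_prod : product_distribution P1)
  (theta01 : theta P1 <> theta P0)
  (Y_model : change_model Pr Y T P0 P1)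
  (* C m n is formed from Y m, ..., Y n *)
  (C : nat -> nat -> Om -> set Th)
  (C_adapted : forall m n t, (1 <= m <= n)%N ->
     obs_sigma Y [set i | (m <= i <= n)%N] [set om | C m n om t])
  (* level 1 - alpha and width, for C 1 up to T and for C m with m > T *)
  (C_cover_pre : (1 - alpha)%:E <=
     Pr [set om | forall n, (1 <= n <= T)%N -> C 1%N n om (theta P0)])
  (C_width_pre : forall n, (1 <= n <= T)%N ->
     {ae Pr, forall om, diam (C 1%N n om) <= w n P0 alpha})
  (C_cover_post : forall m, (T < m)%N -> (1 - alpha)%:E <=
     Pr [set om | forall n, (m <= n)%N -> C m n om (theta P1)])
  (C_width_post : forall m n, (T < m <= n)%N ->
     {ae Pr, forall om, diam (C m n om) <= w (n - m + 1)%N P1 alpha}) :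
  (* (1) non-partitioned problem *)
  ((1 <= T)%N ->
   w T P0 alpha < (mdist (theta P0) (theta P1))%:E ->
   cond_expectation Pr
     [set om | forall n, (1 <= n <= T)%N -> C 1%N n om (theta P0)]
     (delay T (repeated_FCS R setT C)) <=
   (3 / (1 - alpha))%:E *
   first_time R (fun n =>
     w T P0 alpha + w n P1 alpha < (mdist (theta P0) (theta P1))%:E)) /\
  (* (2) partitioned problem *)
  (forall Th0 : set Th, Th0 (theta P0) -> ~ Th0 (theta P1) ->
   \int[Pr]_om delay T (repeated_FCS R Th0 C) om <=
   (3 / (1 - alpha))%:E *
   first_time R (fun n => w n P1 alpha < dist_to Th0 (theta P1))).
Proof.
have /andP[alpha0 alpha1] := alpha01.
have c0 : (0 < 3 / (1 - alpha))%R by rewrite divr_gt0// subr_gt0.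
have slack n : (n%:R / (1 - alpha))%:E <= (3 / (1 - alpha))%:E * n%:R%:E :> \bar R.
  rewrite -EFinM lee_fin mulrAC ler_wpM2r ?invr_ge0 ?subr_ge0 ?(ltW alpha1)//.
  by rewrite ler_peMl// ler1n.
have mY : forall n, measurable_fun setT (Y n) by case: Y_model.
split=> [T1 _ | Th0 Th00 _].
  set E := [set om | _] in C_cover_pre *.
  have sE : obs_sigma Y [set n | (1 <= n <= T)%N] E.
    rewrite [E](_ : _ = \bigcap_(n in [set n | (1 <= n <= T)%N])
      [set om | C 1%N n om (theta P0)])//.
    apply: (@bigcap_measurableType _ (g_sigma_algebraType (obs_events Y _))).
    move=> n /andP[n1 nT]; apply: obs_sigma_subset (C_adapted 1%N n _ _) => // i.
    by move=> /= /andP[-> /leq_trans]; apply.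
  have mE := obs_sigma_measurable Y _ mY _ sE.
  have PE : Pr E = (fine (Pr E))%:E by rewrite fineK ?fin_num_measure.
  have PE0 : (0 < fine (Pr E))%R.
    by rewrite -lte_fin -PE (lt_le_trans _ C_cover_pre)// lte_fin subr_gt0.
  apply: le_mul_first_time => // u u1 wu; apply: le_trans (slack u).
  rewrite /cond_expectation PE inver gt_eqF// lee_pdivrMr// -PE.
  apply: (integral_repeated_FCS_delay_le (theta P1) (w u P1 alpha) alpha _ Y _ P0 P1) => //.
    by move=> m n Tmn <-; exact: C_width_post.
  apply: filterS (C_width_pre T _) => [om widthT Eom A A1 diamA t At|]; last by rewrite T1 /=.
  (* On [E] the set C^(1)_T is the one that [A] misses. *)
  exists 1%N, T; split; first by rewrite T1 /=.
  move=> /= C1t; move: wu; apply/negP; rewrite -leNgt.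
  apply: (@le_trans _ _ ((mdist (theta P0) t)%:E + (mdist t (theta P1))%:E)).
    by rewrite -EFinD lee_fin metric_triangle.
  apply: leeD.
    by apply: le_trans widthT; apply: mdist_le_diam => //; apply: Eom; rewrite T1 /=.
  by apply: le_trans diamA; exact: mdist_le_diam.
apply: le_mul_first_time => // u u1 wu; apply: le_trans (slack u).
rewrite -[leRHS]mule1 -(probability_setT Pr).
apply: (integral_repeated_FCS_delay_le (theta P1) (w u P1 alpha) alpha _ Y _ P0 P1) => //.
- by move=> m n Tmn <-; exact: C_width_post.
- exact: (@measurableT _ (g_sigma_algebraType (obs_events Y _))).
(* Here [A] misses C^(0) = [Th0], which is in force at every time, 0 included. *)
apply: aeW => om _ A A1 diamA t At; exists 0%N, 0%N; split=> //= Th0t.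
move: wu; apply/negP; rewrite -leNgt.
apply: (@le_trans _ _ (mdist t (theta P1))%:E).
  by apply: ereal_inf_lbound; exists t.
by apply: le_trans diamA; exact: mdist_le_diam.
Qed.
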